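(* For each $\alpha\in(1,2)$ let $(\lambda_1,\lambda_2,\lambda_3)$ be a real triple (possibly depending on $\alpha$) chosen in the set $\mathcal{S}_1$ or $\mathcal{S}_2$ or $\mathcal{S}_3$, and assume that $$Q(\theta,\alpha;\lambda_1,\lambda_2,\lambda_3)=\Big(2\sin\frac{\theta}{2}\Big)^{\alpha}\Big(\lambda_1\cos\big(\tfrac{\alpha}{2}(\theta-\pi)-\theta\big)+\lambda_2\cos\big(\tfrac{\alpha}{2}(\theta-\pi)\big)+\lambda_3\cos\big(\tfrac{\alpha}{2}(\theta-\pi)+\theta\big)\Big)\le 0$$ for all $\theta\in[0,\pi]$ and $1<\alpha<2$. Then the implicit WSGD scheme $$U_j^{n+1}=U_j^n-\tau v_x\frac{U_{j+1}^{n+1}-U_{j-1}^{n+1}}{2h}+\frac{d_x\tau}{h^{\alpha}}\sum_{k=0}^{j+1}g_k^{(\alpha)}U_{j-k+1}^{n+1}+\frac{d_x\tau}{h^{\alpha}}\sum_{k=0}^{N_x-j+1}g_k^{(\alpha)}U_{j+k-1}^{n+1}+\tau f_j^{n+1}$$ is unconditionally von Neumann stable.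
   Context: The scheme discretizes the problem $u_t+v_x\partial_x u=d_x({}_aD_x^{\alpha}+{}_xD_b^{\alpha})u+f$ on $(a,b)\times[0,T]$ with initial data and Dirichlet boundary data, where $1<\alpha<2$ and $v_x>0$, $d_x>0$ are constants, and ${}_aD_x^{\alpha}$, ${}_xD_b^{\alpha}$ are the left and right Riemann–Liouville derivatives. Here $\tau>0$ is the time step, $h=(b-a)/N_x$ the space step, $x_j=a+jh$, $t_n=n\tau$, $f_j^n=f(x_j,t_n)$, and $U_j^n$ is the approximation of $u(x_j,t_n)$. Weights: $w_k^{(\alpha)}=(-1)^k\binom{\alpha}{k}=\frac{\Gamma(k-\alpha)}{\Gamma(-\alpha)\Gamma(k+1)}$, and $g_0^{(\alpha)}=\lambda_1w_0^{(\alpha)}$, $g_1^{(\alpha)}=\lambda_1w_1^{(\alpha)}+\lambda_2w_0^{(\alpha)}$, $g_k^{(\alpha)}=\lambda_1w_k^{(\alpha)}+\lambda_2w_{k-1}^{(\alpha)}+\lambda_3w_{k-2}^{(\alpha)}$ for $k\ge2$. Parameter sets (three parametrizations of the real solutions of $\lambda_1+\lambda_2+\lambda_3=1$, $\lambda_1-\lambda_3=\frac{\alpha}{2}$): $\mathcal{S}_1$: $\lambda_1$ given, $\lambda_2=\frac{2+\alpha}{2}-2\lambda_1$, $\lambda_3=\lambda_1-\frac{\alpha}{2}$; $\mathcal{S}_2$: $\lambda_2$ given, $\lambda_1=\frac{2+\alpha}{4}-\frac{\lambda_2}{2}$, $\lambda_3=\frac{2-\alpha}{4}-\frac{\lambda_2}{2}$;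 $\mathcal{S}_3$: $\lambda_3$ given, $\lambda_1=\frac{\alpha}{2}+\lambda_3$, $\lambda_2=\frac{2-\alpha}{2}-2\lambda_3$. Von Neumann stability: consider the perturbation (error) equation of the scheme, i.e. the scheme with $f=0$, extended by zero to the whole lattice so that both upper summation limits $j+1$ and $N_x-j+1$ are replaced by $\infty$ and $j\in\mathbb{Z}$. Inserting $\epsilon_j^n=\rho^n e^{ij\theta}$ ($i=\sqrt{-1}$) determines the amplification factor $\rho=\rho(\theta)$. The scheme is unconditionally von Neumann stable if, for every $\tau>0$ and $h>0$, $|\rho(\theta)|\le1$ for all $\theta\in[-\pi,\pi]$. *)

(* Defs.v *)
(* Stdlib real numbers with Coquelicot (complex numbers and series). *)
From Stdlib Require Import Reals ZArith.
From Coquelicot Require Import Coquelicot.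
Open Scope R_scope.

Fixpoint gbinom (alpha : R) (k : nat) : R :=
  match k with
  | O => 1
  | S k' => gbinom alpha k' * (alpha - INR k') / INR (S k')
  end.

Definition w (alpha : R) (k : nat) : R := (-1) ^ k * gbinom alpha k.

Definition g (alpha l1 l2 l3 : R) (k : nat) : R :=
  match k with
  | O => l1 * w alpha 0
  | S O => l1 * w alpha 1 + l2 * w alpha 0
  | S (S k' as k1) => l1 * w alpha k + l2 * w alpha k1 + l3 * w alpha k'
  end.

Definition S1 (alpha l1 l2 l3 : R) : Prop :=
  l2 = (2 + alpha) / 2 - 2 * l1 /\ l3 = l1 - alpha / 2.

Definition S2 (alpha l1 l2 l3 : R) : Prop :=
  l1 = (2 + alpha) / 4 - l2 / 2 /\ l3 = (2 - alpha) / 4 - l2 / 2.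

Definition S3 (alpha l1 l2 l3 : R) : Prop :=
  l1 = alpha / 2 + l3 /\ l2 = (2 - alpha) / 2 - 2 * l3.

(* Real power of a nonnegative base with [0 ^ y = 0] for [y > 0];
   [Rpower 0 y] is 1. *)
Definition rpow (x y : R) : R := if Rlt_dec 0 x then Rpower x y else 0.

Definition Q (theta alpha l1 l2 l3 : R) : R :=
  rpow (2 * sin (theta / 2)) alpha *
  (l1 * cos (alpha / 2 * (theta - PI) - theta)
   + l2 * cos (alpha / 2 * (theta - PI))
   + l3 * cos (alpha / 2 * (theta - PI) + theta)).

(* A grid function, [U n j] being the value at time level [n] and node [j]. *)
Definition grid_fun : Type := nat -> Z -> C.

(* [s] is the sum of [a k] for [0 <= k <= m] (upper limit [Some m]), or the sum
   of the convergent series of all [a k] (upper limit [None]). *)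
Definition is_sum_upto (m : option Z) (a : nat -> C) (s : C) : Prop :=
  match m with
  | Some m => s = sum_n a (Z.to_nat m)
  | None => is_series a s
  end.

(* A finite-difference scheme: [sch N tau h f U] says that [U] solves the scheme
   with time step [tau], space step [h] and source [f]. With [N = Some Nx] the
   space nodes are [0, ..., Nx]; with [N = None] they are the whole lattice. *)
Definition scheme : Type :=
  option nat -> R -> R -> grid_fun -> grid_fun -> Prop.

Definition interior (N : option nat) (j : Z) : Prop :=
  match N with
  | Some Nx => (0 < j < Z.of_nat Nx)%Z
  | None => True
  end.

Definition left_limit (N : option nat) (j : Z) : option Z :=
  match N with
  | Some _ => Some (j + 1)%Z
  | None => None
  end.

Definition right_limit (N : option nat) (j : Z) : option Z :=
  match N with
  | Some Nx => Some (Z.of_nat Nx - j + 1)%Z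
  | None => None
  end.

Definition wsgd_scheme (vx dx alpha l1 l2 l3 : R) : scheme :=
  fun N tau h f U =>
  forall (n : nat) (j : Z), interior N j ->
  exists sl sr : C,
    is_sum_upto (left_limit N j)
      (fun k => RtoC (g alpha l1 l2 l3 k) * U (S n) (j - Z.of_nat k + 1)%Z)%C sl
    /\ is_sum_upto (right_limit N j)
      (fun k => RtoC (g alpha l1 l2 l3 k) * U (S n) (j + Z.of_nat k - 1)%Z)%C sr
    /\ U (S n) j =
       (U n j
        - RtoC (tau * vx) * ((U (S n) (j + 1)%Z - U (S n) (j - 1)%Z) / RtoC (2 * h))
        + RtoC (dx * tau / Rpower h alpha) * sl
        + RtoC (dx * tau / Rpower h alpha) * sr
        + RtoC tau * f (S n) j)%C.

Definition cis (x : R) : C := (cos x, sin x).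

Definition fourier_mode (rho : C) (theta : R) : grid_fun :=
  fun n j => (Cpow rho n * cis (IZR j * theta))%C.

(* The error equation is the source-free scheme on the whole lattice. *)
Definition amplification_factor
    (sch : scheme) (tau h theta : R) (rho : C) : Prop :=
  sch None tau h (fun _ _ => RtoC 0) (fourier_mode rho theta).

Definition unconditionally_von_neumann_stable (sch : scheme) : Prop :=
  forall tau h : R, 0 < tau -> 0 < h ->
  forall theta : R, - PI <= theta <= PI ->
  exists rho : C,
    unique (amplification_factor sch tau h theta) rho /\ Cmod rho <= 1.

(* Main.v *)
Require Import Defs.
From Stdlib Require Import Reals ZArith Lra Lia.
From Coquelicot Require Import Coquelicot.
Open Scope R_scope.

(** Put [z = exp(-i theta)]. Because the scheme is implicit, inserting the mode
    [rho^n exp(i j theta)] yields the linear equation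
    [rho (1 + i A - D (G(theta) + G(-theta))) = 1], where
    [A = tau vx sin(theta) / h] comes from the central difference,
    [D = dx tau / h^alpha > 0], and [G(theta) = sum_k g_k exp(i (1-k) theta)]
    ([amplification_factor_iff]). The two symbols are conjugate, and their sum is
    [2 Q(|theta|)] ([weights_symbol]). As [Q <= 0], the bracket has real part at
    least 1, hence modulus at least 1; so [rho] exists, is unique and lies in the
    closed unit disc.

    The analytic part is the formula for [G]. Since [g] is a combination of three
    shifts of [w], it rests on the binomial series at the boundary of its disc of
    convergence: [sum_k w_k z^k = (1 - z)^alpha] with [|z| = 1]
    ([binomial_series_circle]). Along the ray [r z], [0 <= r < 1], the series
    satisfies [(1 - r z) F' = - alpha z F], whose solution is
    [exp (alpha log (1 - r z))] ([complex_exponential_ode]); the weights are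
    absolutely summable, so Abel's theorem carries the identity to [r = 1]. At
    [z = 1] the logarithm diverges, and [sum_k w_k = 0] is obtained by
    telescoping instead ([is_series_w]). *)

(** * The Gruenwald weights *)

Lemma w_succ (alpha : R) (k : nat) :
  INR (S k) * w alpha (S k) = (INR k - alpha) * w alpha k.
Proof.
  unfold w; cbn [gbinom pow].
  field; apply not_0_INR; lia.
Qed.

Lemma w_nonneg (alpha : R) (k : nat) :
  1 < alpha < 2 -> 0 <= w alpha (S (S k)).
Proof.
  intros Ha; induction k as [|k IH].
  - unfold w; simpl; nra.
  - pose proof (w_succ alpha (S (S k))) as E.
    pose proof (pos_INR k).
    rewrite !S_INR in E.
    assert (0 <= (INR k + 1 + 1 - alpha) * w alpha (S (S k)))
      by (apply Rmult_le_pos; lra).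
    nra.
Qed.

(** The recurrence [w_succ] makes the sum telescope, since it says
    [(k+1) w_{k+1} - k w_k = - alpha w_k]. *)
Lemma w_partial_sum (alpha : R) (n : nat) :
  alpha <> 0 ->
  sum_n (w alpha) n = - (INR (S n) * w alpha (S n)) / alpha.
Proof.
  intros Ha; induction n as [|n IH].
  - rewrite sum_O, w_succ; unfold w; simpl; field; exact Ha.
  - rewrite sum_Sn, IH, (w_succ alpha (S n)).
    change (- (INR (S n) * w alpha (S n)) / alpha + w alpha (S n)
      = - ((INR (S n) - alpha) * w alpha (S n)) / alpha).
    field; exact Ha.
Qed.

(** The sequence [k (k-1) w_k] decreases from [k = 2] on: its step is
    [- (alpha - 1) k w_k]. Hence [k w_k = O(1/k)], which sends the telescoped
    partial sums to zero. *)
Lemma w_decay (alpha : R) (n : nat) :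
  1 < alpha < 2 ->
  INR (S (S n)) * INR (S n) * w alpha (S (S n)) <= alpha * (alpha - 1).
Proof.
  intros Ha; induction n as [|n IH].
  - unfold w; simpl; nra.
  - pose proof (w_succ alpha (S (S n))) as E.
    pose proof (w_nonneg alpha n Ha) as W.
    pose proof (pos_INR (S (S n))).
    replace (INR (S (S (S n))) * INR (S (S n)) * w alpha (S (S (S n))))
      with (INR (S (S n)) * ((INR (S (S n)) - alpha) * w alpha (S (S n))))
      by (rewrite <- E; ring).
    refine (Rle_trans _ _ _ _ IH).
    rewrite (S_INR (S n)) in *.
    assert (0 <= (INR (S n) + 1) * w alpha (S (S n)) * (alpha - 1))
      by (apply Rmult_le_pos; [apply Rmult_le_pos|]; lra).
    nra.
Qed.

(** This is the binomial identity at the point [z = 1], where the argument of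
    [1 - z] makes no sense. It also gives the absolute convergence used
    everywhere else, because all weights but the first two are nonnegative. *)
Lemma is_series_w (alpha : R) : 1 < alpha < 2 -> is_series (w alpha) 0.
Proof.
  intros Ha.
  enough (L : is_lim_seq (sum_n (w alpha)) 0) by exact L.
  apply is_lim_seq_incr_1.
  apply is_lim_seq_le_le
    with (u := fun n => - (alpha - 1) * / INR (S n)) (w := fun _ => 0).
  - intros n; rewrite w_partial_sum by lra.
    pose proof (w_nonneg alpha n Ha) as W.
    pose proof (w_decay alpha n Ha) as D.
    pose proof (lt_0_INR (S n) ltac:(lia)) as P.
    pose proof (lt_0_INR (S (S n)) ltac:(lia)) as P2.
    assert (0 <= INR (S (S n)) * w alpha (S (S n)))
      by (apply Rmult_le_pos; lra).
    split.
    + apply Rmult_le_reg_r with (alpha * INR (S n)); [nra|].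
      field_simplify; lra.
    + apply Rmult_le_reg_r with alpha; [lra|].
      field_simplify; lra.
  - replace (Finite 0) with (Rbar_mult (- (alpha - 1)) 0)
      by (simpl; f_equal; ring).
    apply is_lim_seq_scal_l.
    replace (Finite 0) with (Rbar_inv p_infty) by reflexivity.
    apply is_lim_seq_inv; [|discriminate].
    apply (is_lim_seq_incr_1 INR), is_lim_seq_INR.
  - apply is_lim_seq_const.
Qed.

Lemma ex_series_Rabs_w (alpha : R) :
  1 < alpha < 2 -> ex_series (fun k => Rabs (w alpha k)).
Proof.
  intros Ha.
  apply (ex_series_incr_n _ 2).
  apply ex_series_ext with (fun k => w alpha (2 + k)).
  - intros k; symmetry; apply Rabs_pos_eq, w_nonneg, Ha.
  - apply (ex_series_incr_n (w alpha) 2).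
    exists 0; apply is_series_w, Ha.
Qed.

(** * From the open disc to the circle *)

Lemma ex_series_Rabs_mult_bounded (a b : nat -> R) :
  (forall k, Rabs (b k) <= 1) -> ex_series (fun k => Rabs (a k)) ->
  ex_series (fun k => Rabs (a k * b k)).
Proof.
  intros Hb Ha.
  apply (ex_series_le (K := R_AbsRing) (V := R_CompleteNormedModule))
    with (2 := Ha).
  intros k; change (norm (Rabs (a k * b k))) with (Rabs (Rabs (a k * b k))).
  rewrite Rabs_Rabsolu, Rabs_mult.
  rewrite <- (Rmult_1_r (Rabs (a k))) at 2.
  apply Rmult_le_compat_l; [apply Rabs_pos | apply Hb].
Qed.

Lemma CV_radius_ge_1 (a : nat -> R) :
  ex_series (fun k => Rabs (a k)) -> Rbar_le 1 (CV_radius a).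
Proof.
  intros H; apply Rbar_not_lt_le; intros L.
  apply (CV_disk_outside a 1).
  - rewrite Rabs_R1; exact L.
  - apply is_lim_seq_ext with a.
    + intros n; rewrite pow1; ring.
    + apply ex_series_lim_0, ex_series_Rabs, H.
Qed.

(** Abel's limit theorem without fixing the radius of convergence: the sequence
    [w_k cos (k theta)] may have radius one or more, and beyond radius one the
    sum is continuous at 1. *)
Lemma PSeries_left_limit_1 (a : nat -> R) :
  ex_series (fun k => Rabs (a k)) ->
  filterlim (PSeries a) (at_left 1) (locally (Series a)).
Proof.
  intros H.
  pose proof (CV_radius_ge_1 a H) as L.
  rewrite <- PSeries_1.
  destruct (Rbar_le_lt_or_eq_dec _ _ L) as [L' | E].
  - apply (filterlim_filter_le_1 (F := locally 1)).
    + intros P HP; unfold at_left, within.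
      apply filter_imp with (2 := HP); auto.
    + apply (continuity_pt_filterlim (PSeries a) 1), PSeries_continuity.
      rewrite Rabs_R1; exact L'.
  - pose proof (Abel a) as A; rewrite <- E in A.
    apply A; simpl; try lra; try exact I.
    apply ex_pseries_1, ex_series_Rabs, H.
Qed.

Lemma is_series_left_limit (a : nat -> R) (f : R -> R) :
  ex_series (fun k => Rabs (a k)) ->
  (forall r, 0 < r < 1 -> PSeries a r = f r) ->
  continuous f 1 -> is_series a (f 1).
Proof.
  intros H E C.
  replace (f 1) with (Series a);
    [apply Series_correct, ex_series_Rabs, H |].
  apply (filterlim_locally_unique (F := at_left 1) (PSeries a)).
  - apply PSeries_left_limit_1, H.
  - apply filterlim_ext_loc with f.
    + exists (mkposreal 1 Rlt_0_1); intros y By Ly.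
      symmetry; apply E.
      apply Rabs_lt_between in By; unfold minus, plus, opp in By; simpl in By.
      lra.
    + apply (filterlim_filter_le_1 (F := locally 1)); [|exact C].
      intros P HP; apply filter_imp with (2 := HP); auto.
Qed.

(** The complex equation [F' = alpha L' F] with [F = u + i v], [L = l + i psi],
    [L' = p + i q], whose solution with [F(0) = 1], [L(0) = 0] is
    [exp (alpha L)]. *)
Lemma complex_exponential_ode (alpha x : R) (u v l psi p q : R -> R) :
  0 < x -> u 0 = 1 -> v 0 = 0 -> l 0 = 0 -> psi 0 = 0 ->
  (forall t, 0 <= t <= x ->
     is_derive u t (alpha * (p t * u t - q t * v t))
     /\ is_derive v t (alpha * (p t * v t + q t * u t))
     /\ is_derive l t (p t) /\ is_derive psi t (q t)) ->
  u x = exp (alpha * l x) * cos (alpha * psi x)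
  /\ v x = exp (alpha * l x) * sin (alpha * psi x).
Proof.
  intros Hx U0 V0 L0 P0 D.
  (* [M + i N] is [F exp (- alpha L)], which has zero derivative. *)
  set (M := fun t => exp (- (alpha * l t))
     * (u t * cos (alpha * psi t) + v t * sin (alpha * psi t))).
  set (N := fun t => exp (- (alpha * l t))
     * (v t * cos (alpha * psi t) - u t * sin (alpha * psi t))).
  assert (E : M 0 = M x /\ N 0 = N x).
  { split; apply (eq_is_derive (V := R_NormedModule)); try exact Hx;
      intros t Ht; destruct (D t Ht) as (Du & Dv & Dl & Dp); unfold M, N;
      (auto_derive; [repeat split; eexists; eassumption |]);
      rewrite (is_derive_unique (fun y : R => u y) _ _ Du),
        (is_derive_unique (fun y : R => v y) _ _ Dv),
        (is_derive_unique (fun y : R => l y) _ _ Dl),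
        (is_derive_unique (fun y : R => psi y) _ _ Dp);
      change (@zero R_NormedModule) with 0; ring. }
  destruct E as [EM EN].
  unfold M, N in EM, EN.
  rewrite U0, V0, L0, P0, !Rmult_0_r, Ropp_0, exp_0, cos_0, sin_0 in EM, EN.
  rewrite exp_Ropp in EM, EN.
  pose proof (exp_pos (alpha * l x)) as E.
  set (e := exp (alpha * l x)) in *.
  pose proof (sin2_cos2 (alpha * psi x)) as T; unfold Rsqr in T.
  set (c := cos (alpha * psi x)) in *.
  set (s := sin (alpha * psi x)) in *.
  assert (EM' : u x * c + v x * s = e).
  { transitivity (e * (/ e * (u x * c + v x * s))); [field; lra|].
    rewrite <- EM; ring. }
  assert (EN' : v x * c - u x * s = 0).
  { transitivity (e * (/ e * (v x * c - u x * s))); [field; lra|].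
    rewrite <- EN; ring. }
  split.
  - transitivity (c * (u x * c + v x * s) - s * (v x * c - u x * s)
      + u x * (1 - (s * s + c * c))); [ring|].
    rewrite EM', EN', T; ring.
  - transitivity (s * (u x * c + v x * s) + c * (v x * c - u x * s)
      + v x * (1 - (s * s + c * c))); [ring|].
    rewrite EM', EN', T; ring.
Qed.

(** Applied to the coefficients of [(1 - z)^alpha], the Euler operator
    [r d/dr - alpha] shifts them by one index (see [w_succ]); this is how the
    differential equation of the binomial series is read off its
    coefficients. *)
Lemma PSeries_binomial_operator (alpha r : R) (a : nat -> R) :
  Rbar_lt (Rabs r) (CV_radius a) ->
  is_pseries (fun k => (INR k - alpha) * a k) r
    (r * PSeries (PS_derive a) r - alpha * PSeries a r).
Proof.
  intros Hr.
  pose proof (PSeries_correct _ _ (ex_pseries_derive a r Hr)) as D.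
  pose proof (PSeries_correct _ _ (CV_radius_inside a r Hr)) as A.
  apply is_pseries_incr_1 in D.
  apply (is_pseries_scal (- alpha)) in A; [|apply Rmult_comm].
  unfold Rminus; rewrite Ropp_mult_distr_l.
  refine (is_pseries_ext _ _ _ _ _ (is_pseries_plus _ _ _ _ _ D A)).
  intros [|n]; unfold PS_plus, PS_incr_1, PS_derive, PS_scal.
  - change (0 + - alpha * a O = (INR 0 - alpha) * a O); simpl; ring.
  - change (INR (S n) * a (S n) + - alpha * a (S n)
      = (INR (S n) - alpha) * a (S n)); ring.
Qed.

(** With [z = r exp(-i theta)], the functions [PSeries a] and [PSeries b] are the
    real and imaginary parts of [F(r) = sum_k w_k z^k]. The equation
    [(1 - r e) F' = - alpha e F], [e = exp(-i theta)], is solved for [F'] here: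
    [p + i q = - e / (1 - r e)] is the logarithmic derivative of [1 - r e]. *)
Lemma is_derive_binomial_mode (alpha theta r : R) :
  1 < alpha < 2 -> 0 <= r < 1 -> cos theta < 1 ->
  let a := fun k => w alpha k * cos (INR k * theta) in
  let b := fun k => w alpha k * - sin (INR k * theta) in
  let p := (r - cos theta) / (1 - 2 * r * cos theta + r * r) in
  let q := sin theta / (1 - 2 * r * cos theta + r * r) in
  is_derive (PSeries a) r (alpha * (p * PSeries a r - q * PSeries b r))
  /\ is_derive (PSeries b) r (alpha * (p * PSeries b r + q * PSeries a r)).
Proof.
  intros Ha Hr Hc a b p q.
  assert (Ra : Rbar_lt (Rabs r) (CV_radius a)).
  { apply Rbar_lt_le_trans with 1.
    - simpl; rewrite Rabs_pos_eq; lra.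
    - apply CV_radius_ge_1, ex_series_Rabs_mult_bounded, ex_series_Rabs_w, Ha.
      intros k; apply Rabs_le, COS_bound. }
  assert (Rb : Rbar_lt (Rabs r) (CV_radius b)).
  { apply Rbar_lt_le_trans with 1.
    - simpl; rewrite Rabs_pos_eq; lra.
    - apply CV_radius_ge_1, ex_series_Rabs_mult_bounded, ex_series_Rabs_w, Ha.
      intros k; rewrite Rabs_Ropp; apply Rabs_le, SIN_bound. }
  pose proof (PSeries_binomial_operator alpha r a Ra) as A.
  pose proof (PSeries_binomial_operator alpha r b Rb) as B.
  set (da := PSeries (PS_derive a) r) in *.
  set (db := PSeries (PS_derive b) r) in *.
  set (c := cos theta) in *; set (s := sin theta) in *.
  (* [E1] and [E2] are the two parts of [F' = e (r F' - alpha F)]. *)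
  assert (E1 : da = c * (r * da - alpha * PSeries a r)
                    + s * (r * db - alpha * PSeries b r)).
  { apply is_pseries_unique.
    refine (is_pseries_ext _ _ _ _ _ (is_pseries_plus _ _ _ _ _
      (is_pseries_scal c _ _ _ (Rmult_comm _ _) A)
      (is_pseries_scal s _ _ _ (Rmult_comm _ _) B))).
    intros n; unfold PS_plus, PS_scal, PS_derive, a, b.
    change (c * ((INR n - alpha) * (w alpha n * cos (INR n * theta)))
      + s * ((INR n - alpha) * (w alpha n * - sin (INR n * theta)))
      = INR (S n) * (w alpha (S n) * cos (INR (S n) * theta))).
    rewrite <- (Rmult_assoc (INR (S n))), (w_succ alpha n), S_INR, Rmult_plus_distr_r,
      Rmult_1_l, cos_plus.
    fold c s; ring. }
  assert (E2 : db = c * (r * db - alpha * PSeries b r)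
                    + - s * (r * da - alpha * PSeries a r)).
  { apply is_pseries_unique.
    refine (is_pseries_ext _ _ _ _ _ (is_pseries_plus _ _ _ _ _
      (is_pseries_scal c _ _ _ (Rmult_comm _ _) B)
      (is_pseries_scal (- s) _ _ _ (Rmult_comm _ _) A))).
    intros n; unfold PS_plus, PS_scal, PS_derive, a, b.
    change (c * ((INR n - alpha) * (w alpha n * - sin (INR n * theta)))
      + - s * ((INR n - alpha) * (w alpha n * cos (INR n * theta)))
      = INR (S n) * (w alpha (S n) * - sin (INR (S n) * theta))).
    rewrite <- (Rmult_assoc (INR (S n))), (w_succ alpha n), S_INR, Rmult_plus_distr_r,
      Rmult_1_l, sin_plus.
    fold c s; ring. }
  assert (T : s * s + c * c = 1) by apply sin2_cos2.
  assert (Hm : 0 < 1 - 2 * r * c + r * r).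
  { assert (-1 <= c) by apply COS_bound.
    replace (1 - 2 * r * c + r * r)
      with ((1 - r) * (1 - r) + 2 * r * (1 - c)) by ring.
    assert (0 < (1 - r) * (1 - r)) by (apply Rmult_lt_0_compat; lra).
    assert (0 <= r * (1 - c)) by (apply Rmult_le_pos; lra).
    lra. }
  set (m := 1 - 2 * r * c + r * r) in *.
  set (x := PSeries a r) in *; set (y := PSeries b r) in *.
  (* Multiplication by the conjugate of [1 - r e], of squared modulus [m]. *)
  assert (F1 : m * da = alpha * ((r - c) * x - s * y)).
  { apply Rminus_diag_uniq; unfold m.
    replace (1 - 2 * r * c + r * r)
      with (1 - 2 * r * c + r * r * (s * s + c * c)) by (rewrite T; ring).
    replace ((r - c) * x) with ((r * (s * s + c * c) - c) * x)
      by (rewrite T; ring).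
    transitivity ((1 - r * c) * (da - (c * (r * da - alpha * x)
         + s * (r * db - alpha * y)))
      + r * s * (db - (c * (r * db - alpha * y)
         + - s * (r * da - alpha * x)))); [ring|].
    rewrite <- E1, <- E2; ring. }
  assert (F2 : m * db = alpha * ((r - c) * y + s * x)).
  { apply Rminus_diag_uniq; unfold m.
    replace (1 - 2 * r * c + r * r)
      with (1 - 2 * r * c + r * r * (s * s + c * c)) by (rewrite T; ring).
    replace ((r - c) * y) with ((r * (s * s + c * c) - c) * y)
      by (rewrite T; ring).
    transitivity ((1 - r * c) * (db - (c * (r * db - alpha * y)
         + - s * (r * da - alpha * x)))
      - r * s * (da - (c * (r * da - alpha * x)
         + s * (r * db - alpha * y)))); [ring|].
    rewrite <- E1, <- E2; ring. }
  split.
  - replace (alpha * (p * x - q * y)) with da.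
    + apply is_derive_PSeries, Ra.
    + apply Rmult_eq_reg_l with m; [|lra].
      rewrite F1; unfold p, q; field; lra.
  - replace (alpha * (p * y + q * x)) with db.
    + apply is_derive_PSeries, Rb.
    + apply Rmult_eq_reg_l with m; [|lra].
      rewrite F2; unfold p, q; field; lra.
Qed.

(** Modulus and argument of
    [1 - exp(-i theta) = 2 sin(theta/2) exp(i (PI - theta)/2)], in the form in
    which they appear as values at [r = 1] of the logarithm of
    [1 - r exp(-i theta)]. *)
Lemma half_angle_values (theta : R) :
  0 < theta <= PI ->
  ln (1 - 2 * 1 * cos theta + 1 * 1) / 2 = ln (2 * sin (theta / 2))
  /\ atan (1 * sin theta / (1 - 1 * cos theta)) = (PI - theta) / 2.
Proof.
  intros Ht.
  assert (Hs : 0 < sin (theta / 2)) by (apply sin_gt_0; lra).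
  assert (E : theta = 2 * (theta / 2)) by field.
  pose proof (cos_2a_sin (theta / 2)) as C2; rewrite <- E in C2.
  pose proof (sin_2a (theta / 2)) as S2; rewrite <- E in S2.
  split.
  - replace (1 - 2 * 1 * cos theta + 1 * 1)
      with ((2 * sin (theta / 2)) * (2 * sin (theta / 2)))
      by (rewrite C2; ring).
    rewrite ln_mult by lra; field.
  - rewrite <- (atan_tan ((PI - theta) / 2)) by lra; f_equal.
    unfold tan.
    replace ((PI - theta) / 2) with (PI / 2 - theta / 2) by field.
    rewrite sin_shift, cos_shift, C2, S2.
    replace (1 - 1 * (1 - 2 * sin (theta / 2) * sin (theta / 2)))
      with (2 * sin (theta / 2) * sin (theta / 2)) by ring.
    field; lra.
Qed.

(** The boundary values [sum_k w_k exp(-i k theta) = (1 - exp(-i theta))^alpha].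
    The differential equation gives the identity for [r exp(-i theta)] with
    [r < 1], and both sides have limits as [r] tends to 1: the left one by
    Abel's theorem, the right one because [1 - r exp(-i theta)] stays away from
    zero when [theta] is not zero. *)
Lemma binomial_series_circle (alpha theta : R) :
  1 < alpha < 2 -> 0 <= theta <= PI ->
  is_series (fun k => w alpha k * cos (INR k * theta))
    (rpow (2 * sin (theta / 2)) alpha * cos (alpha / 2 * (theta - PI)))
  /\ is_series (fun k => w alpha k * - sin (INR k * theta))
    (- (rpow (2 * sin (theta / 2)) alpha * sin (alpha / 2 * (theta - PI)))).
Proof.
  intros Ha [H0 HP]; destruct H0 as [H0 | <-].
  2: { unfold rpow; replace (0 / 2) with 0 by field.
    rewrite sin_0, Rmult_0_r.
    destruct (Rlt_dec 0 0) as [L|_]; [lra|].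
    rewrite !Rmult_0_l, Ropp_0.
    split.
    - apply is_series_ext with (w alpha); [|apply is_series_w, Ha].
      intros k; rewrite Rmult_0_r, cos_0; symmetry; apply Rmult_1_r.
    - apply is_series_ext with (fun k => 0 * w alpha k).
      + intros k; rewrite Rmult_0_r, sin_0, Ropp_0; apply Rmult_comm.
      + pose proof (is_series_scal (V := R_NormedModule) 0 _ _
          (is_series_w alpha Ha)) as Z.
        change (is_series (fun k => 0 * w alpha k) (0 * 0)) in Z.
        rewrite Rmult_0_r in Z; exact Z. }
  destruct (half_angle_values theta (conj H0 HP)) as [L1 A1].
  assert (Hs : 0 < sin (theta / 2)) by (apply sin_gt_0; lra).
  assert (C1 : cos theta < 1)
    by (rewrite <- cos_0; apply cos_decreasing_1; lra).
  (* Since [1 - r exp(-i theta)] has positive real part, its argument is an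
     arctangent. *)
  set (l := fun r => ln (1 - 2 * r * cos theta + r * r) / 2).
  set (psi := fun r => atan (r * sin theta / (1 - r * cos theta))).
  set (a := fun k => w alpha k * cos (INR k * theta)).
  set (b := fun k => w alpha k * - sin (INR k * theta)).
  assert (Pd : forall r, 0 <= r <= 1 -> 0 < 1 - r * cos theta).
  { intros r Hr; replace (1 - r * cos theta)
      with ((1 - r) + r * (1 - cos theta)) by ring.
    destruct (proj1 Hr) as [Hr0 | <-]; [|lra].
    pose proof (Rmult_lt_0_compat r (1 - cos theta) Hr0 ltac:(lra)); lra. }
  assert (Pm : forall r, 0 <= r <= 1 -> 0 < 1 - 2 * r * cos theta + r * r).
  { intros r Hr; pose proof (Pd r Hr).
    pose proof (sin2_cos2 theta) as T; unfold Rsqr in T.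
    replace (1 - 2 * r * cos theta + r * r)
      with ((1 - r * cos theta) * (1 - r * cos theta)
            + r * r * (1 - cos theta * cos theta)) by ring.
    replace (1 - cos theta * cos theta) with (sin theta * sin theta) by lra.
    nra. }
  assert (Dl : forall r, 0 <= r <= 1 ->
    is_derive l r ((r - cos theta) / (1 - 2 * r * cos theta + r * r))).
  { intros r Hr; pose proof (Pm r Hr); unfold l; auto_derive; [lra|].
    field; lra. }
  assert (Dp : forall r, 0 <= r <= 1 ->
    is_derive psi r (sin theta / (1 - 2 * r * cos theta + r * r))).
  { intros r Hr; pose proof (Pm r Hr); pose proof (Pd r Hr).
    unfold psi; auto_derive; [lra|].
    pose proof (sin2_cos2 theta) as T; unfold Rsqr in T.
    assert (E : 1 - 2 * r * cos theta + r * r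
      = (1 - r * cos theta) * (1 - r * cos theta)
        + r * sin theta * (r * sin theta)).
    { transitivity (1 - 2 * r * cos theta
        + r * r * (sin theta * sin theta + cos theta * cos theta));
        [rewrite T|]; ring. }
    rewrite E in *; field; lra. }
  assert (Sol : forall r, 0 < r < 1 ->
    PSeries a r = exp (alpha * l r) * cos (alpha * psi r)
    /\ PSeries b r = exp (alpha * l r) * sin (alpha * psi r)).
  { intros r Hr.
    apply complex_exponential_ode
      with (p := fun t => (t - cos theta) / (1 - 2 * t * cos theta + t * t))
           (q := fun t => sin theta / (1 - 2 * t * cos theta + t * t)).
    - lra.
    - rewrite PSeries_0; unfold a; simpl; rewrite Rmult_0_l, cos_0.
      unfold w; simpl; ring.
    - rewrite PSeries_0; unfold b; simpl; rewrite Rmult_0_l, sin_0; ring.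
    - unfold l; replace (1 - 2 * 0 * cos theta + 0 * 0) with 1 by ring.
      rewrite ln_1; field.
    - unfold psi; rewrite Rmult_0_l; unfold Rdiv; rewrite Rmult_0_l.
      apply atan_0.
    - intros t Ht.
      destruct (is_derive_binomial_mode alpha theta t Ha ltac:(lra) C1)
        as [Da Db].
      refine (conj Da (conj Db (conj (Dl t _) (Dp t _)))); lra. }
  assert (Cl : ex_derive l 1) by (eexists; apply Dl; lra).
  assert (Cp : ex_derive psi 1) by (eexists; apply Dp; lra).
  assert (R1 : exp (alpha * l 1) = rpow (2 * sin (theta / 2)) alpha).
  { unfold rpow, l; rewrite L1.
    destruct (Rlt_dec 0 (2 * sin (theta / 2))); [reflexivity | lra]. }
  assert (P1 : alpha * psi 1 = - (alpha / 2 * (theta - PI)))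
    by (unfold psi; rewrite A1; field).
  split.
  - rewrite <- R1, <- cos_neg, <- P1.
    apply (is_series_left_limit a (fun r => exp (alpha * l r) * cos (alpha * psi r))).
    + apply ex_series_Rabs_mult_bounded, ex_series_Rabs_w, Ha.
      intros k; apply Rabs_le, COS_bound.
    + apply Sol.
    + apply (ex_derive_continuous (V := R_NormedModule)); auto_derive; auto.
  - rewrite <- R1, Ropp_mult_distr_r, <- sin_neg, <- P1.
    apply (is_series_left_limit b (fun r => exp (alpha * l r) * sin (alpha * psi r))).
    + apply ex_series_Rabs_mult_bounded, ex_series_Rabs_w, Ha.
      intros k; rewrite Rabs_Ropp; apply Rabs_le, SIN_bound.
    + apply Sol.
    + apply (ex_derive_continuous (V := R_NormedModule)); auto_derive; auto.
Qed.

(** * The symbol of the weights *)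

Lemma cis_plus (x y : R) : cis (x + y) = (cis x * cis y)%C.
Proof.
  unfold cis, Cmult; simpl; rewrite cos_plus, sin_plus; f_equal; ring.
Qed.

Lemma cis_0 : cis 0 = 1%C.
Proof. unfold cis; rewrite cos_0, sin_0; reflexivity. Qed.

Lemma is_series_C (a : nat -> C) (s : C) :
  is_series (fun k => fst (a k)) (fst s) ->
  is_series (fun k => snd (a k)) (snd s) -> is_series a s.
Proof.
  intros H1 H2; unfold is_series in *.
  assert (E : forall n, sum_n a n
     = (sum_n (fun k => fst (a k)) n, sum_n (fun k => snd (a k)) n)).
  { intros n; induction n as [|n IH].
    - rewrite !sum_O; apply surjective_pairing.
    - rewrite !sum_Sn, IH; reflexivity. }
  apply filterlim_locally; intros eps.
  pose proof (proj1 (filterlim_locally _ _) H1 eps) as F1.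
  pose proof (proj1 (filterlim_locally _ _) H2 eps) as F2.
  generalize (filter_and _ _ F1 F2); apply filter_imp.
  intros n Hn; rewrite E; exact Hn.
Qed.

Lemma is_series_shift (a : nat -> C) (s : C) :
  is_series a s ->
  is_series (fun k => match k with O => RtoC 0 | S k' => a k' end) s.
Proof.
  intros H; apply is_series_decr_1.
  match goal with |- is_series _ ?l => replace l with s end; [exact H|].
  change (s = (s + - RtoC 0)%C); ring.
Qed.

(** The weights [g] are the Cauchy product of [w] with the three numbers [l1],
    [l2], [l3]; so their symbol is a trigonometric polynomial times that
    of [w]. *)
Lemma is_series_shifted_weights (alpha l1 l2 l3 theta : R) (s : C) :
  is_series (fun k => (RtoC (w alpha k) * cis (- (INR k * theta)))%C) s ->
  is_series (fun k => (RtoC (g alpha l1 l2 l3 k) * cis ((1 - INR k) * theta))%C)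
    ((RtoC l1 * cis theta + RtoC l2 + RtoC l3 * cis (- theta)) * s)%C.
Proof.
  intros H0.
  pose proof (is_series_shift _ _ H0) as H1.
  pose proof (is_series_shift _ _ H1) as H2.
  pose proof (is_series_plus _ _ _ _
    (is_series_plus _ _ _ _
      (is_series_scal (RtoC l1 * cis theta)%C _ _ H0)
      (is_series_scal (RtoC l2) _ _ H1))
    (is_series_scal (RtoC l3 * cis (- theta))%C _ _ H2)) as H.
  match type of H with is_series _ ?l =>
    replace (_ * s)%C with l end.
  2: { change (RtoC l1 * cis theta * s + RtoC l2 * s + RtoC l3 * cis (- theta) * s
        = (RtoC l1 * cis theta + RtoC l2 + RtoC l3 * cis (- theta)) * s)%C; ring. }
  refine (is_series_ext _ _ _ _ H).
  intros [|[|k]].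
  - change (RtoC l1 * cis theta * (RtoC (w alpha 0) * cis (- (INR 0 * theta)))
      + RtoC l2 * RtoC 0 + RtoC l3 * cis (- theta) * RtoC 0
      = RtoC (l1 * w alpha 0) * cis ((1 - INR 0) * theta))%C.
    simpl INR.
    replace ((1 - 0) * theta) with theta by ring.
    replace (- (0 * theta)) with 0 by ring.
    rewrite cis_0, RtoC_mult; ring.
  - change (RtoC l1 * cis theta * (RtoC (w alpha 1) * cis (- (INR 1 * theta)))
      + RtoC l2 * (RtoC (w alpha 0) * cis (- (INR 0 * theta)))
      + RtoC l3 * cis (- theta) * RtoC 0
      = RtoC (l1 * w alpha 1 + l2 * w alpha 0) * cis ((1 - INR 1) * theta))%C.
    simpl INR.
    replace ((1 - 1) * theta) with 0 by ring.
    replace (- (0 * theta)) with 0 by ring.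
    replace (- (1 * theta)) with (- theta) by ring.
    rewrite RtoC_plus, !RtoC_mult.
    transitivity (RtoC l1 * RtoC (w alpha 1) * (cis theta * cis (- theta))
       + RtoC l2 * RtoC (w alpha 0) * cis 0)%C; [ring|].
    rewrite <- cis_plus, Rplus_opp_r; ring.
  - set (c := cis ((1 - INR (S (S k))) * theta)).
    change (RtoC l1 * cis theta
        * (RtoC (w alpha (S (S k))) * cis (- (INR (S (S k)) * theta)))
      + RtoC l2 * (RtoC (w alpha (S k)) * cis (- (INR (S k) * theta)))
      + RtoC l3 * cis (- theta) * (RtoC (w alpha k) * cis (- (INR k * theta)))
      = RtoC (l1 * w alpha (S (S k)) + l2 * w alpha (S k) + l3 * w alpha k) * c)%C.
    transitivity (
      RtoC l1 * RtoC (w alpha (S (S k)))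
        * (cis theta * cis (- (INR (S (S k)) * theta)))
      + RtoC l2 * RtoC (w alpha (S k)) * cis (- (INR (S k) * theta))
      + RtoC l3 * RtoC (w alpha k)
        * (cis (- theta) * cis (- (INR k * theta))))%C; [ring|].
    rewrite <- !cis_plus.
    replace (theta + - (INR (S (S k)) * theta))
      with ((1 - INR (S (S k))) * theta) by ring.
    replace (- (INR (S k) * theta)) with ((1 - INR (S (S k))) * theta)
      by (rewrite !S_INR; ring).
    replace (- theta + - (INR k * theta)) with ((1 - INR (S (S k))) * theta)
      by (rewrite !S_INR; ring).
    fold c; rewrite !RtoC_plus, !RtoC_mult; ring.
Qed.

(** The left and right symbols are complex conjugates, and [Q] is their common
    real part; this is where the hypothesis on [Q] meets the scheme. *)
Lemma weights_symbol_nonneg_angle (alpha l1 l2 l3 theta : R) :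
  1 < alpha < 2 -> 0 <= theta <= PI ->
  exists sl sr : C,
    is_series (fun k => (RtoC (g alpha l1 l2 l3 k) * cis ((1 - INR k) * theta))%C) sl
    /\ is_series (fun k => (RtoC (g alpha l1 l2 l3 k) * cis ((1 - INR k) * - theta))%C) sr
    /\ (sl + sr)%C = RtoC (2 * Q theta alpha l1 l2 l3).
Proof.
  intros Ha Ht.
  destruct (binomial_series_circle alpha theta Ha Ht) as [HX HY].
  unfold Q.
  set (m := rpow (2 * sin (theta / 2)) alpha) in *.
  set (phi := alpha / 2 * (theta - PI)) in *.
  exists ((RtoC l1 * cis theta + RtoC l2 + RtoC l3 * cis (- theta))
          * ((m * cos phi)%R, (- (m * sin phi))%R))%C.
  exists ((RtoC l1 * cis (- theta) + RtoC l2 + RtoC l3 * cis (- - theta))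
          * ((m * cos phi)%R, (m * sin phi)%R))%C.
  split; [|split].
  - apply is_series_shifted_weights, is_series_C; simpl.
    + refine (is_series_ext _ _ _ _ HX); intros k.
      rewrite cos_neg, Rmult_0_l, Rminus_0_r; reflexivity.
    + refine (is_series_ext _ _ _ _ HY); intros k.
      rewrite sin_neg, Rmult_0_l, Rplus_0_r; reflexivity.
  - apply is_series_shifted_weights, is_series_C; simpl.
    + refine (is_series_ext _ _ _ _ HX); intros k.
      replace (- (INR k * - theta)) with (INR k * theta) by ring.
      rewrite Rmult_0_l, Rminus_0_r; reflexivity.
    + rewrite <- (Ropp_involutive (m * sin phi)).
      refine (is_series_ext _ _ _ _ (is_series_opp _ _ HY)); intros k.
      replace (- (INR k * - theta)) with (INR k * theta) by ring.
      change (- (w alpha k * - sin (INR k * theta))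
        = w alpha k * sin (INR k * theta) + 0 * cos (INR k * theta)); ring.
  - rewrite Ropp_involutive.
    unfold cis, RtoC, Cmult, Cplus; simpl.
    rewrite cos_neg, sin_neg, cos_minus, cos_plus.
    f_equal; ring.
Qed.

Lemma weights_symbol (alpha l1 l2 l3 theta : R) :
  1 < alpha < 2 -> - PI <= theta <= PI ->
  exists sl sr : C,
    is_series (fun k => (RtoC (g alpha l1 l2 l3 k) * cis ((1 - INR k) * theta))%C) sl
    /\ is_series (fun k => (RtoC (g alpha l1 l2 l3 k) * cis ((INR k - 1) * theta))%C) sr
    /\ (sl + sr)%C = RtoC (2 * Q (Rabs theta) alpha l1 l2 l3).
Proof.
  intros Ha Ht.
  destruct (weights_symbol_nonneg_angle alpha l1 l2 l3 (Rabs theta) Ha)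
    as (sl & sr & Hl & Hr & E).
  { split; [apply Rabs_pos | apply Rabs_le; lra]. }
  destruct (Rle_lt_dec 0 theta) as [P | N].
  - exists sl, sr; split; [|split; [|exact E]].
    + refine (is_series_ext _ _ _ _ Hl); intros k; rewrite Rabs_pos_eq by lra.
      reflexivity.
    + refine (is_series_ext _ _ _ _ Hr); intros k; rewrite Rabs_pos_eq by lra.
      do 2 f_equal; ring.
  - exists sr, sl; split; [|split; [|rewrite <- E; apply Cplus_comm]].
    + refine (is_series_ext _ _ _ _ Hr); intros k; rewrite Rabs_left by lra.
      do 2 f_equal; ring.
    + refine (is_series_ext _ _ _ _ Hl); intros k; rewrite Rabs_left by lra.
      do 2 f_equal; ring.
Qed.

(** * Amplification factor and stability *)

Lemma is_series_C_unique (a : nat -> C) (s t : C) :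
  is_series a s -> is_series a t -> s = t.
Proof. exact (filterlim_locally_unique _ s t). Qed.

(** A Fourier mode is an eigenvector of every spatial operator of the scheme, so
    the error equation at level [n] is [rho^n] times one scalar equation.
    Only the level [n = 0] determines [rho]: the others would also
    admit [rho = 0]. *)
Lemma amplification_factor_iff
  (vx dx alpha l1 l2 l3 tau h theta : R) (rho sl sr : C) :
  0 < h ->
  is_series (fun k => (RtoC (g alpha l1 l2 l3 k) * cis ((1 - INR k) * theta))%C) sl ->
  is_series (fun k => (RtoC (g alpha l1 l2 l3 k) * cis ((INR k - 1) * theta))%C) sr ->
  amplification_factor (wsgd_scheme vx dx alpha l1 l2 l3) tau h theta rho
  <-> (rho * (1 + RtoC (tau * vx / h * sin theta) * Ci
         - RtoC (dx * tau / Rpower h alpha) * (sl + sr)))%C = 1%C.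
Proof.
  intros Hh Hl Hr.
  set (D := RtoC (dx * tau / Rpower h alpha)).
  assert (Lt : forall n j, is_series (fun k => RtoC (g alpha l1 l2 l3 k)
      * fourier_mode rho theta (S n) (j - Z.of_nat k + 1)%Z)%C
      (fourier_mode rho theta (S n) j * sl)%C).
  { intros n j.
    refine (is_series_ext _ _ _ _
      (is_series_scal (fourier_mode rho theta (S n) j) _ _ Hl)).
    intros k; unfold fourier_mode.
    replace (IZR (j - Z.of_nat k + 1) * theta)
      with (IZR j * theta + (1 - INR k) * theta)
      by (rewrite plus_IZR, minus_IZR, <- INR_IZR_INZ; ring).
    rewrite cis_plus.
    match goal with |- scal ?x ?y = ?z => change (@eq C (x * y)%C z) end.
    ring. }
  assert (Rt : forall n j, is_series (fun k => RtoC (g alpha l1 l2 l3 k)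
      * fourier_mode rho theta (S n) (j + Z.of_nat k - 1)%Z)%C
      (fourier_mode rho theta (S n) j * sr)%C).
  { intros n j.
    refine (is_series_ext _ _ _ _
      (is_series_scal (fourier_mode rho theta (S n) j) _ _ Hr)).
    intros k; unfold fourier_mode.
    replace (IZR (j + Z.of_nat k - 1) * theta)
      with (IZR j * theta + (INR k - 1) * theta)
      by (rewrite minus_IZR, plus_IZR, <- INR_IZR_INZ; ring).
    rewrite cis_plus.
    match goal with |- scal ?x ?y = ?z => change (@eq C (x * y)%C z) end.
    ring. }
  assert (A : forall n j, (RtoC (tau * vx)
      * ((fourier_mode rho theta (S n) (j + 1)%Z
          - fourier_mode rho theta (S n) (j - 1)%Z) / RtoC (2 * h))
      = fourier_mode rho theta (S n) j
        * (RtoC (tau * vx / h * sin theta) * Ci))%C).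
  { intros n j; unfold fourier_mode.
    replace (IZR (j + 1) * theta) with (IZR j * theta + theta)
      by (rewrite plus_IZR; ring).
    replace (IZR (j - 1) * theta) with (IZR j * theta + - theta)
      by (rewrite minus_IZR; ring).
    rewrite !cis_plus.
    replace (cis (- theta)) with (cis theta - RtoC (2 * sin theta) * Ci)%C.
    2: { unfold cis, Cminus, Cplus, Copp, Cmult, RtoC, Ci; simpl.
      rewrite cos_neg, sin_neg; f_equal; ring. }
    unfold Rdiv; rewrite !RtoC_mult, RtoC_inv by lra.
    field; intros Z; apply RtoC_inj in Z; lra. }
  split.
  - intros H; destruct (H O 0%Z I) as (s1 & s2 & H1 & H2 & E).
    rewrite (is_series_C_unique _ _ _ H1 (Lt O 0%Z)),
      (is_series_C_unique _ _ _ H2 (Rt O 0%Z)), A in E.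
    unfold fourier_mode in E; rewrite Rmult_0_l, cis_0 in E.
    simpl Cpow in E; fold D in E.
    match type of E with ?x = ?y => transitivity (x - y + 1)%C end.
    + ring.
    + rewrite <- E; ring.
  - intros E n j _.
    exists (fourier_mode rho theta (S n) j * sl)%C,
      (fourier_mode rho theta (S n) j * sr)%C.
    split; [apply Lt|split; [apply Rt|]].
    rewrite A; fold D.
    assert (F : fourier_mode rho theta n j
      = (fourier_mode rho theta (S n) j
         * (1 + RtoC (tau * vx / h * sin theta) * Ci - D * (sl + sr)))%C).
    { symmetry; transitivity (fourier_mode rho theta n j
        * (rho * (1 + RtoC (tau * vx / h * sin theta) * Ci - D * (sl + sr))))%C.
      - unfold fourier_mode; simpl Cpow; ring.
      - rewrite E; ring. }
    rewrite F; ring.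
Qed.

Theorem theorem4 (vx dx : R) (lam1 lam2 lam3 : R -> R)
  (hvx : 0 < vx) (hdx : 0 < dx)
  (hS : forall alpha : R, 1 < alpha < 2 ->
     S1 alpha (lam1 alpha) (lam2 alpha) (lam3 alpha)
     \/ S2 alpha (lam1 alpha) (lam2 alpha) (lam3 alpha)
     \/ S3 alpha (lam1 alpha) (lam2 alpha) (lam3 alpha))
  (hQ : forall theta alpha : R, 0 <= theta <= PI -> 1 < alpha < 2 ->
     Q theta alpha (lam1 alpha) (lam2 alpha) (lam3 alpha) <= 0) :
  forall alpha : R, 1 < alpha < 2 ->
  unconditionally_von_neumann_stable
    (wsgd_scheme vx dx alpha (lam1 alpha) (lam2 alpha) (lam3 alpha)).
Proof.
  intros alpha Ha tau h Htau Hh theta Ht.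
  destruct (weights_symbol alpha (lam1 alpha) (lam2 alpha) (lam3 alpha) theta Ha Ht)
    as (sl & sr & Hl & Hr & E).
  pose proof (fun rho => amplification_factor_iff vx dx alpha (lam1 alpha)
    (lam2 alpha) (lam3 alpha) tau h theta rho sl sr Hh Hl Hr) as Char.
  set (z := (1 + RtoC (tau * vx / h * sin theta) * Ci
         - RtoC (dx * tau / Rpower h alpha) * (sl + sr))%C) in Char.
  assert (Hre : 1 <= fst z).
  { unfold z; rewrite E; unfold Cminus, Cplus, Copp, Cmult, RtoC, Ci; simpl.
    set (q := Q _ _ _ _ _).
    assert (Hq : q <= 0).
    { apply hQ; [|exact Ha].
      split; [apply Rabs_pos | apply Rabs_le; lra]. }
    assert (HD : 0 < dx * tau / Rpower h alpha).
    { apply Rdiv_lt_0_compat; [apply Rmult_lt_0_compat; lra | apply exp_pos]. }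
    set (d := dx * tau / Rpower h alpha) in *.
    assert (0 <= d * - q) by (apply Rmult_le_pos; lra).
    lra. }
  assert (Hmod : 1 <= Cmod z).
  { apply Rle_trans with (2 := re_le_Cmod z).
    apply Rle_trans with (1 := Hre), Rle_abs. }
  assert (Hz : z <> 0%C) by (apply Cmod_gt_0; lra).
  exists (/ z)%C; split; [split|].
  - apply Char; field; exact Hz.
  - intros rho' H; apply Char in H.
    transitivity (/ z * (rho' * z))%C; [rewrite H; ring | field; exact Hz].
  - rewrite Cmod_inv by exact Hz.
    rewrite <- Rinv_1; apply Rinv_le_contravar; lra.
Qed.
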